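(* Let $(\mathfrak g,[\cdot,\cdot])$ be a semisimple Lie algebra with Killing form $\kappa$, endowed with the linear Poisson bracket $\{F,G\}_{\mathfrak g}(L)=\kappa(L,[\nabla F(L),\nabla G(L)])$ and with the pseudo-Riemannian metric $g=\kappa$. Then for every $G\in C^\infty(\mathfrak g)$ the generalized double bracket vector field $\partial_{\mathcal M}G$ coincides with the classical double bracket vector field: $$\partial_{\mathcal M}G(L)=[L,[L,\nabla G(L)]],\qquad L\in\mathfrak g .$$
   Context: $\mathfrak g$ is a finite-dimensional real semisimple Lie algebra. The gradient $\nabla F(L)\in\mathfrak g$ of $F\in C^\infty(\mathfrak g)$ is taken with respect to the Killing form: $\kappa(\nabla F(L),X)=\mathrm dF(L)(X)$ for all $X\in\mathfrak g$. For a Poisson manifold $(M,\Pi)$ with $\Pi(\mathrm dF,\mathrm dG)=\{F,G\}$, equipped with a pseudo-Riemannian metric $g$: $\sharp_\Pi\colon T^*M\to TM$ is defined by $\beta(\sharp_\Pi\alpha)=\Pi(\alpha,\beta)$; the metriplectic tensor field is the symmetric contravariant 2-tensor field $\mathcal M(\alpha,\beta):=g(\sharp_\Pi\alpha,\sharp_\Pi\beta)$, $\alpha,\beta\in\Omega^1(M)$; and the generalized double bracket (GDB) vector field of $G\in C^\infty(M)$ is $\partial_{\mathcal M}G:=-i_{\mathrm dG}\mathcal M$, i.e. $\beta(\partial_{\mathcal M}G)=-\mathcal M(\mathrm dG,\beta)$ for all $\beta\in\Omega^1(M)$. *)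

(* Defs.v *)
From HB Require Import structures.
From mathcomp Require Import all_boot all_order all_algebra.
From mathcomp Require Import all_classical all_reals all_analysis.

Set Implicit Arguments.
Unset Strict Implicit.
Unset Printing Implicit Defensive.

Import Order.TTheory GRing.Theory Num.Theory.
Import numFieldNormedType.Exports.
Import passmx.

Local Open Scope classical_set_scope.
Local Open Scope ring_scope.

HB.mixin Record Vector_isLieAlgebra (K : fieldType) g of Vector K g := {
  lie : g -> g -> g;
  lie_linearl : forall y, linear (lie^~ y);
  lie_linearr : forall x, linear (lie x);
  liexx : forall x, lie x x = 0;
  lie_jacobi : forall x y z,
    lie x (lie y z) + lie y (lie z x) + lie z (lie x y) = 0
}.

#[short(type="lieAlgType")]
HB.structure Definition LieAlgebra (K : fieldType) :=
  {g of Vector K g & Vector_isLieAlgebra K g}.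

Notation "[lie x , y ]" := (lie x y)
  (at level 0, x, y at level 99, format "[lie  x ,  y ]") : ring_scope.

Section LieAlgebraTheory.
Variables (K : fieldType) (g : lieAlgType K).
Implicit Types (x y : g) (U V : {vspace g}).

Definition ad x : 'End(g) := linfun (lie x).

Definition killing x y : K :=
  \tr (mxof (vbasis {:g}) (vbasis {:g}) (ad x \o ad y)%VF).

(* By bilinearity, this is the span of all [lie u, v], u \in U and v \in V. *)
Definition liev U V : {vspace g} :=
  <<[seq [lie u, v] | u <- vbasis U, v <- vbasis V]>>%VS.

Definition lie_ideal U := forall x u, u \in U -> [lie x, u] \in U.

Definition derived_series U k := iter k (fun V => liev V V) U.

Definition lie_solvable U := exists k, derived_series U k = 0%VS.

Definition semisimple := forall U, lie_ideal U -> lie_solvable U -> U = 0%VS.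

End LieAlgebraTheory.

Arguments semisimple {K} g.

Section Smooth.
Variables (R : realType).

Fixpoint continuously_differentiable n (k : nat) (f : 'rV[R]_n -> R^o) : Prop :=
  if k is k'.+1 then
    (forall x, differentiable f x) /\
    (forall v, continuously_differentiable k' (fun x => 'D_v f x))
  else continuous f.

(* A finite-dimensional space carries no canonical norm in the library; its    *)
(* manifold structure is the one given by linear coordinates. The choice of    *)
(* the basis is immaterial for both definitions below.                         *)
Variable (V : vectType R).

Definition in_coord (F : V -> R) : 'rV[R]_(\dim {:V}) -> R^o :=
  F \o vecof (vbasis {:V}).

Definition smooth (F : V -> R) :=
  forall k, continuously_differentiable k (in_coord F).

Definition differential (F : V -> R) (L : V) : 'Hom(V, R^o) :=
  linfun (fun X =>
    'd (in_coord F) (rVof (vbasis {:V}) L) (rVof (vbasis {:V}) X)).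

End Smooth.

(* The manifold is a vector space V, all of whose tangent spaces are V and     *)
(* cotangent spaces 'Hom(V, R^o); tensor fields are given pointwise. A vector  *)
(* defined by its pairings is the element picked by xget; it would be 0 if     *)
(* there were none.                                                            *)
Section Metriplectic.
Variables (R : realType) (V : vectType R).
Local Notation covector := 'Hom(V, R^o).

Definition contravariant2_field := V -> 'Hom(covector, 'Hom(covector, R^o)).

(* Every covector at L is the differential of a linear, hence smooth, function,*)
(* so bracket determines Pi, and Pi is skew-symmetric when bracket is.         *)
Definition poisson_tensor_of (bracket : (V -> R) -> (V -> R) -> V -> R)
    (Pi : contravariant2_field) :=
  forall F G, smooth F -> smooth G ->
  forall L, Pi L (differential F L) (differential G L) = bracket F G L.

Variables (Pi : contravariant2_field) (metric : V -> V -> V -> R).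

Definition sharp (L : V) (a : covector) : V :=
  xget 0 [set v | forall b : covector, b v = Pi L a b].

Definition metriplectic (L : V) (a b : covector) : R :=
  metric L (sharp L a) (sharp L b).

Definition gdb (G : V -> R) (L : V) : V :=
  xget 0 [set v | forall b : covector,
                    b v = - metriplectic L (differential G L) b].

End Metriplectic.

Section LiePoisson.
Variables (R : realType) (g : lieAlgType R).

Definition gradient (F : g -> R) (L : g) : g :=
  xget 0 [set v | forall X, killing v X = differential F L X].

Definition lie_poisson_bracket (F G : g -> R) (L : g) : R :=
  killing L [lie gradient F L, gradient G L].

Definition killing_metric (L : g) (X Y : g) : R := killing X Y.

End LiePoisson.

(* Main.v *)
Require Import Defs.
From HB Require Import structures.
From mathcomp Require Import all_boot all_order all_algebra.
From mathcomp Require Import ring complex.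
From mathcomp Require Import all_classical all_reals all_analysis.

Set Implicit Arguments.
Unset Strict Implicit.
Unset Printing Implicit Defensive.

Import Order.TTheory GRing.Theory Num.Theory.
Import numFieldNormedType.Exports.
Import passmx.

Local Open Scope ring_scope.

(* Once the Killing form is nondegenerate, the theorem is a direct computation
   with its invariance: the sharp of dF at L is [L, grad F], and every covector
   is the differential of a linear function.

   Nondegeneracy is Cartan's criterion for the radical S of the Killing form.
   For x in [S, S], let y act on the generalized eigenspace of ad x for a,
   after complexification, as the conjugate of a. Since conjugation is
   additive, y is a derivation; it is also a polynomial in ad x. Invariance
   then gives tr (ad x o y) = 0, but this trace is the sum of the squared moduli
   of the eigenvalues of ad x, so ad x is nilpotent. By Engel's theorem the
   stable term of the derived series of S vanishes, hence S is a solvable ideal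
   and S = 0. *)

(** * Polynomials in a matrix and generalized eigenspaces *)

Lemma coprimep_XsubC_exp (F : fieldType) (a b : F) m n : a != b ->
  coprimep (('X - a%:P) ^+ m) (('X - b%:P) ^+ n).
Proof.
move=> ab; apply/coprimep_expl/coprimep_expr.
by rewrite coprimep_XsubC root_XsubC eq_sym.
Qed.

(** Chinese remaindering, one node at a time: [W] is 0 to order N at the old nodes, and [u * W] is
    moreover 1 to order N at [a], so a multiple of it corrects the value at [a] alone. *)
Lemma hermite_interpolation (F : fieldType) (s : seq F) (f : F -> F) N :
  uniq s -> exists Q : {poly F},
  {in s, forall a, ('X - a%:P) ^+ N %| Q - (f a)%:P}.
Proof.
elim: s => [|a s IHs] /=; first by exists 0.
case/andP=> a_s /IHs[Q0 Q0P].
pose W := \prod_(b <- s) ('X - b%:P) ^+ N.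
have : coprimep W (('X - a%:P) ^+ N).
  rewrite /W coprimep_sym big_seq; elim/big_rec: _ => [|b p b_s cop].
    exact: coprimep1.
  rewrite coprimepMr cop andbT coprimep_XsubC_exp//.
  by apply: contraNneq a_s => ->.
case/Bezout_eq1_coprimepP=> -[u v] /= uv1.
exists (Q0 + ((f a)%:P - Q0) * (u * W)) => b.
rewrite inE => /predU1P[->|b_s].
  have -> : Q0 + ((f a)%:P - Q0) * (u * W) - (f a)%:P
      = (Q0 - (f a)%:P) * v * ('X - a%:P) ^+ N.
    rewrite (_ : u * W = 1 - v * ('X - a%:P) ^+ N); last by rewrite -uv1 addrK.
    by ring.
  exact: dvdp_mulIr.
rewrite addrAC dvdp_add ?Q0P// dvdp_mull// dvdp_mull//.
by rewrite /W (big_rem b)//= dvdp_mulIl.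
Qed.

Lemma horner_mx_geigen (F : fieldType) n (T : 'M[F]_n.+1) (Q : {poly F}) a c N k
    (u : 'rV[F]_n.+1) : ('X - a%:P) ^+ N %| Q - c%:P -> (k <= N)%N ->
  u *m (T - a%:M) ^+ k = 0 -> u *m horner_mx T Q = c *: u.
Proof.
case/dvdpP=> r Qr kN u0; rewrite -[Q](subrK c%:P) Qr rmorphD/= horner_mx_C.
rewrite mulrC -(subnKC kN) exprD -mulrA rmorphM rmorphXn rmorphB/=.
by rewrite horner_mx_X horner_mx_C mulmxDr mulmxA u0 mul0mx add0r mul_mx_scalar.
Qed.

(** The powers of the ['X - a%:P] are pairwise coprime, so their kernels sum to the kernel of the
    product, which is the whole space. *)
Lemma sum_geigen (F : fieldType) n (T : 'M[F]_n.+1) (s : seq F)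
    (u : 'rV[F]_n.+1) :
    uniq s -> mxminpoly T %| \prod_(a <- s) ('X - a%:P) ^+ n.+1 ->
  exists w : F -> 'rV_n.+1, u = \sum_(a <- s) w a /\
    forall a, w a *m (T - a%:M) ^+ n.+1 = 0.
Proof.
move=> s_uniq Tdiv; pose p (i : 'I_(size s)) := ('X - (s`_i)%:P) ^+ n.+1.
have : (u <= \sum_i kermxpoly T (p i))%MS.
  rewrite -kermxpoly_prod; last first.
    move=> i j _ _ ij; rewrite coprimep_XsubC_exp//.
    by rewrite nth_uniq 1?eq_sym.
  rewrite kermxpoly_min ?submx1//.
  by rewrite (big_nth 0) big_mkord in Tdiv.
case/sub_sumsmxP=> w uE.
(* The kernels are indexed by positions in [s], the components by values; as [s] is duplicate-free,
   each inner sum has a single term. *)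
exists (fun a => if a \in s then
  \sum_(i < size s | s`_i == a) w i *m kermxpoly T (p i) else 0); split.
  rewrite uE (big_nth 0) big_mkord; apply: eq_bigr => i _.
  rewrite mem_nth// (bigD1 i)//= big1 ?addr0// => j /andP[/eqP ji nji].
  move/eqP: ji; rewrite nth_uniq// => /eqP/val_inj ji.
  by rewrite ji eqxx in nji.
move=> a; case: ifP => _; last by rewrite mul0mx.
rewrite mulmx_suml big1// => i /eqP <-; rewrite -mulmxA.
suff -> : (T - (s`_i)%:M) ^+ n.+1 = horner_mx T (p i).
  by rewrite /kermxpoly mulmx_ker mulmx0.
by rewrite rmorphXn rmorphB/= horner_mx_X horner_mx_C.
Qed.

(* The induction is on i + j, using
   [u A(v) (T - a - b) = u (T - a) A(v) + u A(v (T - b))]. *)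
Lemma geigen_derivation (F : fieldType) n (T : 'M[F]_n.+1)
    (A : {linear 'rV[F]_n.+1 -> 'M[F]_n.+1}) a b i j (u v : 'rV_n.+1) :
    (forall v, A (v *m T) = A v *m T - T *m A v) ->
    u *m (T - a%:M) ^+ i = 0 -> v *m (T - b%:M) ^+ j = 0 ->
  u *m A v *m (T - (a + b)%:M) ^+ (i + j) = 0.
Proof.
move=> AT; move: {2}(i + j)%N (erefl (i + j)%N) => k.
elim: k i j u v => [|k IHk] i j u v.
  by case: i => // _; rewrite expr0 mulmx1 => -> _; rewrite !mul0mx.
case: i => [|i]; first by rewrite expr0 mulmx1 => _ -> _; rewrite !mul0mx.
case: j => [|j].
  by rewrite expr0 mulmx1 => _ _ ->; rewrite linear0 mulmx0 mul0mx.
have mul_exprS (z : 'rV[F]_n.+1) (X : 'M[F]_n.+1) m :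
  z *m X ^+ m.+1 = z *m X *m X ^+ m by rewrite exprS -mulmxE mulmxA.
move=> [ijk] u0 v0; rewrite !mul_exprS in u0 v0.
rewrite addSn mul_exprS.
have -> : u *m A v *m (T - (a + b)%:M) =
    u *m (T - a%:M) *m A v + u *m A (v *m (T - b%:M)).
  have -> : A (v *m (T - b%:M)) = A v *m T - T *m A v - b *: A v.
    by rewrite mulmxBr mul_mx_scalar linearB linearZ/= AT.
  rewrite !mulmxBr !mul_mx_scalar mulmxBl -scalemxAl -scalemxAr scalerDl.
  rewrite !mulmxA.
  set x := u *m A v *m T; set y := u *m T *m A v; set z := u *m A v.
  by rewrite [RHS]addrC addrACA subrK -opprD (addrC (b *: z)).
rewrite mulmxDl (IHk i j.+1) ?mul_exprS// add0r.
by rewrite addnS -addSn IHk ?mul_exprS// addSn -addnS.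
Qed.

(** Factors are grouped by root; each root occurs at most n times. *)
Lemma prod_XsubC_dvd (F : fieldType) n (d : 'I_n -> F) (s : seq F) :
  uniq s -> (forall i, d i \in s) ->
  \prod_i ('X - (d i)%:P) %| \prod_(a <- s) ('X - a%:P) ^+ n.
Proof.
move=> s_uniq ds.
have -> : \prod_i ('X - (d i)%:P)
    = \prod_(a <- s) \prod_(i | d i == a) ('X - (d i)%:P).
  rewrite (exchange_big_dep predT)//=; apply: eq_bigr => i _.
  rewrite -big_filter (eq_filter (a2 := pred1 (d i))); last first.
    by move=> a /=; rewrite eq_sym.
  by rewrite filter_pred1_uniq// big_seq1.
elim/big_ind2: _ => // [p1 p2 q1 q2|a _]; first exact: dvdp_mul.
rewrite (eq_bigr (fun _ => 'X - a%:P)) => [|i /eqP->//].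
rewrite prodr_const dvdp_exp2l//.
by apply: leq_trans (max_card _) _; rewrite card_ord.
Qed.

Lemma is_trig_mulmx (F : fieldType) n (A B : 'M[F]_n) :
  is_trig_mx A -> is_trig_mx B ->
  is_trig_mx (A *m B) /\ forall i, (A *m B) i i = A i i * B i i.
Proof.
move=> /is_trig_mxP A0 /is_trig_mxP B0; split.
  apply/is_trig_mxP => i j ij; rewrite mxE big1// => k _.
  case: (ltnP i k) => ik; first by rewrite A0 ?mul0r.
  by rewrite B0 ?mulr0// (leq_ltn_trans ik).
move=> i; rewrite mxE (bigD1 i)//= big1 ?addr0// => k ki.
case: (ltngtP i k) => ik; first by rewrite A0 ?mul0r.
  by rewrite B0 ?mulr0.
by rewrite (val_inj ik) eqxx in ki.
Qed.

Lemma is_trig_horner_mx (F : fieldType) n (U : 'M[F]_n.+1) (p : {poly F}) :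
  is_trig_mx U -> is_trig_mx (horner_mx U p) /\
  forall i, (horner_mx U p) i i = p.[U i i].
Proof.
move=> U_trig; elim/poly_ind: p => [|p c [IHt IHd]].
  by rewrite rmorph0; split=> [|i]; rewrite ?mx0_is_trig// mxE horner0.
have [pUt pUd] := is_trig_mulmx IHt U_trig.
rewrite rmorphD rmorphM/= horner_mx_X horner_mx_C; split.
  apply/is_trig_mxP => i j ij; rewrite mxE (is_trig_mxP pUt)// mxE add0r.
  by case: eqP ij => [->|]; rewrite ?ltnn.
by move=> i; rewrite mxE -[_ * U]/(_ *m U) pUd IHd mxE eqxx hornerMXaddC.
Qed.

(** Read [u *m A v] as the bracket of v and u, with operators acting on rows from the right: the
    condition imposed on [T] and on [y] is then that of a derivation. *)
Lemma nilpotent_of_derivation_trace (C : numClosedFieldType) n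
    (A : {linear 'rV[C]_n.+1 -> 'M[C]_n.+1}) (T : 'M[C]_n.+1) :
    (forall v, A (v *m T) = A v *m T - T *m A v) ->
    (forall y, (forall v, A (v *m y) = A v *m y - y *m A v) ->
      \tr (T *m y) = 0) ->
  T ^+ n.+1 = 0.
Proof.
move=> AT trT.
have [P /unitarymx_unit P_unit U_trig] := Schur T (ltn0Sn n).
have UE : conjmx P T = P *m T *m invmx P by rewrite conjumx.
have U_trig' : is_trig_mx (conjmx P T) by [].
set U := conjmx P T in UE U_trig'.
have minU : mxminpoly T %| \prod_i ('X - (U i i)%:P).
  rewrite -char_poly_trig// (_ : mxminpoly T = mxminpoly U).
    exact: mxminpoly_dvd_char.
  by apply: (similar_mxminpoly P_unit); apply/eqP.
pose s0 := undup [seq U i i | i : 'I_n.+1].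
have s0P i : U i i \in s0.
  by rewrite mem_undup (fintype.image_f (fun i => U i i)).
(* A bracket of generalized eigenvectors for a and b is one for a + b, with exponent at most the sum
   of theirs. Hence the extra nodes and the doubled order of interpolation. *)
pose s := undup (s0 ++ [seq a + b | a <- s0, b <- s0]).
have [Q QP] := hermite_interpolation Num.conj (n.+1 + n.+1)
  (undup_uniq _ : uniq s).
have s0s a : a \in s0 -> a \in s.
  by move=> as0; rewrite mem_undup mem_cat as0.
set y := horner_mx T Q.
have decomp u := sum_geigen u (undup_uniq _ : uniq s0)
  (dvdp_trans minU (prod_XsubC_dvd (undup_uniq _) s0P)).
have y_der v : A (v *m y) = A v *m y - y *m A v.
  have [w [-> wP]] := decomp v.
  rewrite mulmx_suml !(linear_sum A)/= mulmx_suml mulmx_sumr -sumrB.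
  rewrite big_seq [RHS]big_seq; apply: eq_bigr => b bs0.
  (* Both arguments of the bracket are now split; on components for a and b the derivation rule
     reads: conj (a + b) - conj a = conj b. *)
  apply/row_matrixP => i; rewrite !rowE.
  have [x [-> xP]] := decomp (delta_mx 0 i).
  rewrite !mulmx_suml big_seq [RHS]big_seq; apply: eq_bigr => a as0.
  rewrite mulmxBr !mulmxA.
  have le1 := leq_addr n.+1 n.+1.
  rewrite (horner_mx_geigen (QP _ (s0s _ bs0)) le1 (wP b)).
  rewrite (horner_mx_geigen (QP _ (s0s _ as0)) le1 (xP a)).
  have abs : a + b \in s.
    by rewrite mem_undup mem_cat allpairs_f ?orbT.
  rewrite (horner_mx_geigen (QP _ abs) (leqnn _)
    (geigen_derivation AT (xP a) (wP b))).
  by rewrite linearZ/= -scalemxAr -scalemxAl -scalerBl rmorphD/= addrC addKr.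
have : \sum_i `|U i i| ^+ 2 = 0.
  have [_ hd] := is_trig_horner_mx ('X * Q) U_trig'.
  have yE : T *m y = horner_mx T ('X * Q) by rewrite rmorphM/= horner_mx_X.
  rewrite -[RHS](trT y y_der) yE.
  rewrite -[horner_mx T _](mulKmx P_unit) mxtrace_mulC -horner_mx_uconj// -UE.
  rewrite /mxtrace; apply: eq_bigr => i _; rewrite hd hornerM hornerX.
  (* The order of interpolation is positive, so [Q] takes the value conj (U i i) at [U i i]. *)
  have := QP _ (s0s _ (s0P i)); rewrite addSn exprS.
  move/(dvdp_trans (dvdp_mulIl _ _)).
  rewrite dvdp_XsubCl rootE !hornerE subr_eq0 => /eqP ->.
  by rewrite normCK.
move/eqP; rewrite psumr_eq0 => [|i _]; last by rewrite exprn_ge0.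
move/allP=> U0.
have {}U0 i : U i i = 0.
  have /= := U0 i (mem_index_enum i).
  by rewrite expf_eq0/= normr_eq0 => /eqP.
have : mxminpoly T %| 'X^(n.+1).
  apply: dvdp_trans minU _; rewrite (eq_bigr (fun _ => 'X)) => [|i _].
    by rewrite prodr_const card_ord.
  by rewrite U0 subr0.
by move/mxminpoly_minP; rewrite rmorphXn/= horner_mx_X.
Qed.

(** Includes dimension 0 and phrases nilpotency by iterates, as [ad_nilpotent] does. *)
Lemma nilpotent_of_derivation_trace_rV (C : numClosedFieldType) n
    (A : {linear 'rV[C]_n -> 'M[C]_n}) (T : 'M[C]_n) :
    (forall v, A (v *m T) = A v *m T - T *m A v) ->
    (forall y, (forall v, A (v *m y) = A v *m y - y *m A v) ->
      \tr (T *m y) = 0) ->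
  exists k, forall v : 'rV_n, iter k (mulmx^~ T) v = 0.
Proof.
case: n => [|n] in A T * => AT trT; first by exists 0 => v; exact: thinmx0.
exists n.+1 => v.
have iterE k : iter k (mulmx^~ T) v = v *m T ^+ k.
  elim: k => [|k IHk]; first by rewrite expr0 mulmx1.
  by rewrite iterS IHk exprSr -mulmxE mulmxA.
by rewrite iterE (nilpotent_of_derivation_trace AT trT) mulmx0.
Qed.

(** * Lie brackets, Engel's theorem and solvability *)

Section LieAlgebra.
Variables (K : fieldType) (g : lieAlgType K).
Implicit Types (x y z : g) (U V W M S D : {vspace g}).

HB.instance Definition _ x :=
  GRing.isLinear.Build K g g _ (lie x) (lie_linearr x).

Lemma lieDl x y z : [lie x + y, z] = [lie x, z] + [lie y, z].
Proof. by have := lie_linearl z 1 x y; rewrite /= !scale1r. Qed.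

Lemma lie0l z : [lie 0, z] = 0.
Proof. by apply: (addrI [lie 0, z]); rewrite -lieDl !addr0. Qed.

Lemma lieZl a x z : [lie a *: x, z] = a *: [lie x, z].
Proof. by have := lie_linearl z a x 0; rewrite /= lie0l !addr0. Qed.

Lemma lie_suml I (r : seq I) (F : I -> g) z :
  [lie \sum_(i <- r) F i, z] = \sum_(i <- r) [lie F i, z].
Proof.
by apply: (big_morph (lie^~ z)) => [x y|]; [exact: lieDl | exact: lie0l].
Qed.

Lemma lieDr x y z : [lie x, y + z] = [lie x, y] + [lie x, z].
Proof. exact: linearD. Qed.

Lemma lieZr a x y : [lie x, a *: y] = a *: [lie x, y].
Proof. exact: linearZ. Qed.

Lemma lieC x y : [lie x, y] = - [lie y, x].
Proof.
have := liexx (x + y); rewrite lieDl !lieDr !liexx addr0 add0r.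
by move/eqP; rewrite addr_eq0 => /eqP.
Qed.

Lemma lie_jacobi_ad x y z :
  [lie [lie x, y], z] = [lie x, [lie y, z]] - [lie y, [lie x, z]].
Proof.
have /eqP := lie_jacobi x y z.
rewrite addr_eq0 => /eqP jac.
by rewrite [LHS]lieC -jac [[lie z, x]]lieC linearN.
Qed.

Lemma adE x y : ad x y = [lie x, y].
Proof. by rewrite lfunE. Qed.

Lemma ad_linear : linear (@ad K g).
Proof.
move=> a x y; apply/lfunP => z.
by rewrite add_lfunE scale_lfunE !adE lieDl lieZl.
Qed.

HB.instance Definition _ := GRing.isLinear.Build K g _ _ (@ad K g) ad_linear.

Lemma mem_liev U V u v : u \in U -> v \in V -> [lie u, v] \in liev U V.
Proof.
move=> /coord_vbasis -> /coord_vbasis ->; rewrite lie_suml memv_suml// => i _.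
rewrite linear_sum/= memv_suml// => j _; rewrite lieZl linearZ/= !memvZ//.
by apply/memv_span/allpairs_f; rewrite mem_nth ?size_tuple.
Qed.

Lemma liev_ind U V (P : g -> Prop) :
  P 0 -> (forall a x y, P x -> P y -> P (a *: x + y)) ->
  (forall u v, u \in U -> v \in V -> P [lie u, v]) ->
  forall x, x \in liev U V -> P x.
Proof.
move=> P0 PD Pl x; rewrite /liev; set r := [seq _ | u <- _, v <- _] => xr.
rewrite (coord_span (X := in_tuple r) xr).
apply: (big_ind P) => // [y z Py|i _]; first by rewrite -[y]scale1r; apply: PD.
rewrite -[X in P X]addr0; apply: PD => //.
have : r`_i \in r by rewrite mem_nth.
by case/allpairsP=> -[u v] /= [/vbasis_mem uU /vbasis_mem vV ->]; apply: Pl.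
Qed.

Lemma liev_subv U V W :
  (forall u v, u \in U -> v \in V -> [lie u, v] \in W) -> (liev U V <= W)%VS.
Proof.
move=> UVW; apply/subvP; apply: liev_ind => //; first exact: mem0v.
by move=> a x y xW yW; rewrite memvD ?memvZ.
Qed.

Definition ad_nilpotent x := exists k, forall v, iter k (lie x) v = 0.

(* Engel's conclusion for every M-stable subquotient W / U of g; with pairs of
   subspaces no quotient has to be formed. *)
Definition engel M := forall U W, (U <= W)%VS -> U != W ->
  (forall m u, m \in M -> u \in U -> [lie m, u] \in U) ->
  (forall m w, m \in M -> w \in W -> [lie m, w] \in W) ->
  exists2 w, w \in W & w \notin U /\ forall m, m \in M -> [lie m, w] \in U.

Lemma subv_neq_witness U W : (U <= W)%VS -> U != W ->
  exists2 w, w \in W & w \notin U.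
Proof.
move=> UW UneW; have /subvPn[w] : ~~ (W <= U)%VS.
  by apply: contraNN UneW => WU; rewrite eqEsubv UW.
by exists w.
Qed.

(** Vectors of W sent into U by M stay so under [lie w], because w normalizes M. Starting from one
    outside U, the iterates of [lie w] end in U by nilpotency; the last one outside U works for M
    and w together. *)
Lemma engel_extend M w : engel M -> ad_nilpotent w ->
  (forall m, m \in M -> [lie m, w] \in M) -> engel (M + <[w]>)%VS.
Proof.
move=> engM [k wk0] Mw U W UW UneW MU MW.
have MS m : m \in M -> m \in (M + <[w]>)%VS.
  exact/subvP/addvSl.
have wS : w \in (M + <[w]>)%VS.
  by apply: (subvP (addvSr _ _)); exact: memv_line.
have [v vW [vU Mv]] := engM U W UW UneW (fun m u mM => MU m u (MS m mM))
  (fun m u mM => MW m u (MS m mM)).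
pose good x := [/\ x \in W, x \notin U & forall m, m \in M -> [lie m, x] \in U].
suff [j [jW jU Mj] wj] : exists2 j, good (iter j (lie w) v) &
    [lie w, iter j (lie w) v] \in U.
  exists (iter j (lie w) v) => //; split=> // z.
  case/memv_addP=> m mM [_ /vlineP[c ->] ->].
  by rewrite lieDl lieZl; apply: memvD; [exact: Mj | exact: memvZ].
have : iter k (lie w) v \in U by rewrite wk0 mem0v.
elim: k {wk0} => [|k IHk]; first by rewrite (negbTE vU).
case kU: (iter k (lie w) v \in U); first by move=> _; exact: IHk.
move=> skU; exists k => //.
elim: k {IHk skU} kU => [_|k IHk kU]; first by [].
have [] := IHk _.
  by apply: contraFF kU => kU; apply: MU.
move=> kW kU' Mk; split; [exact: MW | by rewrite kU | move=> m mM /=].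
have -> : [lie m, [lie w, iter k (lie w) v]] =
    [lie [lie m, w], iter k (lie w) v] + [lie w, [lie m, iter k (lie w) v]].
  by rewrite lie_jacobi_ad subrK.
by apply: memvD; [apply: Mk; exact: Mw | apply: MU => //; exact: Mk].
Qed.

Lemma dim_addv_line U w : w \notin U -> \dim (U + <[w]>) = (\dim U).+1.
Proof.
move=> wU; have w0 : w != 0 by apply: contraNneq wU => ->; exact: mem0v.
rewrite dimv_disjoint_sum ?dim_vline ?w0 ?addn1//.
apply/eqP; rewrite -subv0; apply/subvP => x /memv_capP[xU /vlineP[c xE]].
move: xU; rewrite xE rpredZeq (negbTE wU) orbF => /eqP ->.
by rewrite scale0r mem0v.
Qed.

(** Subalgebras N of M with the property [engel] are enlarged by one line at a time: [engel N]
    applied to M / N yields w outside N that normalizes N, and [engel_extend] adjoins it. *)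
Lemma engel_ad_nilpotent M :
  (forall x y, x \in M -> y \in M -> [lie x, y] \in M) ->
  (forall x, x \in M -> ad_nilpotent x) -> engel M.
Proof.
move=> M_lie M_nil.
suff [N [NM dimN _ engN]] : exists N, [/\ (N <= M)%VS, \dim N = \dim M,
    forall x y, x \in N -> y \in N -> [lie x, y] \in N & engel N].
  by have /eqP <- : N == M by rewrite eqEdim NM dimN /=.
(* The target dimension is generalized to any [e] at most [\dim M], for induction from the zero
   subalgebra. *)
have := leqnn (\dim M); move: {1 3}(\dim M) => e; elim: e => [_|d IHd dM].
  exists 0%VS; split; rewrite ?sub0v ?dimv0//.
    by move=> x y; rewrite !memv0 => /eqP -> _; rewrite lie0l.
  move=> U W UW UneW _ _; have [w wW wU] := subv_neq_witness UW UneW.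
  exists w => //; split=> // m; rewrite memv0 => /eqP ->.
  by rewrite lie0l mem0v.
have [N [NM dimN N_lie engN]] := IHd (ltnW dM).
have [||m n mN nM|w wM [wN Nw]] := engN N M NM.
- by apply/eqP => NE; move: dM; rewrite -NE dimN ltnn.
- exact: N_lie.
- by apply: M_lie => //; apply: (subvP NM).
exists (N + <[w]>)%VS; split.
- by rewrite subv_add NM -memvE.
- by rewrite dim_addv_line ?dimN.
- move=> x y /memv_addP[m mN [_ /vlineP[c ->] ->]].
  case/memv_addP=> [n nN [_ /vlineP[b ->] ->]].
  apply: (subvP (addvSl N <[w]>)).
  rewrite lieDl lieZl !lieDr !lieZr liexx scaler0 addr0.
  apply: memvD; last by rewrite memvZ// lieC memvN Nw.
  by apply: memvD; [exact: N_lie | rewrite memvZ ?Nw].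
- by apply: engel_extend => //; exact: M_nil.
Qed.

(* A D-stable hyperplane U of D together with w in D \ U such that
   [D, w] is in U would contain [D, D] = D. *)
Lemma perfect_ad_nilpotent D : liev D D = D ->
  (forall x, x \in D -> ad_nilpotent x) -> D = 0%VS.
Proof.
move=> DD D_nil.
have D_lie x y : x \in D -> y \in D -> [lie x, y] \in D.
  by move=> xD yD; rewrite -DD mem_liev.
have engD := engel_ad_nilpotent D_lie D_nil.
have step U : (U <= D)%VS -> U != D ->
    (forall x u, x \in D -> u \in U -> [lie x, u] \in U) ->
  exists2 w, w \in D & w \notin U /\
    forall x y, x \in D -> y \in (U + <[w]>)%VS -> [lie x, y] \in U.
  move=> UD UneD DU; have [w wD [wU Dw]] := engD U D UD UneD DU D_lie.
  exists w => //; split=> // x _ xD /memv_addP[u uU [_ /vlineP[c ->] ->]].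
  by rewrite lieDr lieZr; apply: memvD; [exact: DU | apply: memvZ; exact: Dw].
case dimD: (\dim D) => [|d]; first by apply/eqP; rewrite -dimv_eq0 dimD.
suff [U [UD dimU DU]] : exists U, [/\ (U <= D)%VS, \dim U = d &
    forall x u, x \in D -> u \in U -> [lie x, u] \in U].
  have UneD : U != D.
    by apply/eqP => UE; have := ltnn d; rewrite -{2}dimU UE dimD leqnn.
  have [w wD [wU Dw]] := step U UD UneD DU.
  case/negP: (wU); move: (wD); rewrite -{1}DD.
  apply/subvP/liev_subv => x y xD yD.
  apply: Dw => //; suff /eqP -> : (U + <[w]>)%VS == D by [].
  by rewrite eqEdim subv_add UD -memvE wD dim_addv_line// dimD dimU /=.
(* The hyperplane is the end of a chain of D-stable subspaces of dimensions 0 to d; adding w keeps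
   stability, as D sends the sum into U. *)
have := leqnn d; move: {1 3}d => e; elim: e => [_|e IHe ed].
  exists 0%VS; split; rewrite ?sub0v ?dimv0// => x u _.
  by rewrite memv0 => /eqP ->; rewrite linear0 mem0v.
have [U [UD dimU DU]] := IHe (ltnW ed).
have UneD : U != D.
  apply/eqP => UE; have := ltn_trans ed (ltnSn d).
  by rewrite -dimU UE dimD ltnn.
have [w wD [wU Dw]] := step U UD UneD DU.
exists (U + <[w]>)%VS; split.
- by rewrite subv_add UD -memvE.
- by rewrite dim_addv_line ?dimU.
- by move=> x u xD uUw; apply: (subvP (addvSl _ _)); apply: Dw.
Qed.

(** The derived series decreases, so it stabilizes by dimension; its stable term is perfect and lies
    in [S, S], hence vanishes. *)
Lemma lie_solvable_of_ad_nilpotent S :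
  (forall x y, x \in S -> y \in S -> [lie x, y] \in S) ->
  (forall x, x \in liev S S -> ad_nilpotent x) -> lie_solvable S.
Proof.
move=> S_lie S_nil; pose D k := derived_series S k.
have DS k : (D k.+1 <= D k)%VS.
  elim: k => [|k IHk]; apply: liev_subv => x y xD yD; first exact: S_lie.
  by apply: mem_liev; apply: (subvP IHk).
have DS1 k : (D k.+1 <= liev S S)%VS.
  by elim: k => // k IHk; apply: subv_trans IHk.
have [k Dk] : exists k, D k.+1 = D k.
  suff [//|dimD] : (exists k, D k.+1 = D k) \/
      forall k, (\dim (D k) + k <= \dim S)%N.
    by have := leq_trans (leq_addl _ _) (dimD (\dim S).+1); rewrite ltnn.
  case: (boolp.EM (exists k, D k.+1 = D k)) => [|neD]; [by left | right].
  elim=> [|k IHk]; first by rewrite addn0.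
  rewrite addnS -addSn (leq_trans _ IHk)// leq_add2r ltn_neqAle dimvS// andbT.
  apply: contra_notN neD => /eqP dimE; exists k; apply/eqP.
  by rewrite eqEdim DS dimE /=.
(* The index is [k.+1] because [D 0] is S itself, which need not lie in [S, S]. *)
exists k.+1; apply: perfect_ad_nilpotent.
  exact: (congr1 (fun V => liev V V) Dk).
by move=> x /(subvP (DS1 k)); exact: S_nil.
Qed.

End LieAlgebra.

(** * The Killing form and its invariance *)

Section Killing.
Variables (K : fieldType) (g : lieAlgType K).
Implicit Types x y z : g.
Local Notation e := (vbasis {:g}).
Let e_basis : basis_of {:g} e := vbasisP {:g}.

Definition ad_mx x := mxof e e (ad x).

Lemma ad_mx_linear : linear ad_mx.
Proof. by move=> a x y; rewrite /ad_mx !linearP. Qed.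
HB.instance Definition _ := GRing.isLinear.Build K g _ _ ad_mx ad_mx_linear.

Lemma rVof_lie x y : rVof e [lie x, y] = rVof e y *m ad_mx x.
Proof. by rewrite /ad_mx -(rVof_app _ e_basis) adE. Qed.

(** Matrices act on rows from the right, which reverses products and so the commutator. *)
Lemma ad_mx_lie x y :
  ad_mx [lie x, y] = ad_mx y *m ad_mx x - ad_mx x *m ad_mx y.
Proof.
rewrite /ad_mx -!(mxof_comp _ _ e_basis) -linearB/=; congr mxof.
apply/lfunP => z.
by rewrite add_lfunE opp_lfunE !comp_lfunE !adE lie_jacobi_ad.
Qed.

Lemma killingE x y : killing x y = \tr (ad_mx x *m ad_mx y).
Proof. by rewrite /killing (mxof_comp _ _ e_basis) mxtrace_mulC. Qed.

Lemma killingC x y : killing x y = killing y x.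
Proof. by rewrite !killingE mxtrace_mulC. Qed.

Lemma killing_linearr x : linear (killing x : g -> K^o).
Proof.
move=> a y z; rewrite !killingE linearP/= mulmxDr -scalemxAr.
by rewrite mxtraceD mxtraceZ.
Qed.
HB.instance Definition _ x :=
  GRing.isLinear.Build K g K^o _ (killing x : g -> K^o) (killing_linearr x).

Definition killing_form x : 'Hom(g, K^o) := linfun (killing x : g -> K^o).

Lemma killing_formE x y : killing_form x y = killing x y.
Proof. by rewrite lfunE. Qed.

Lemma killing_form_linear : linear killing_form.
Proof.
move=> a x y; apply/lfunP => z; rewrite add_lfunE scale_lfunE !killing_formE.
by rewrite killingC killing_linearr ![killing z _]killingC.
Qed.
HB.instance Definition _ :=
  GRing.isLinear.Build K g _ _ killing_form killing_form_linear.

Definition killing_radical : {vspace g} := lker (linfun killing_form).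

Lemma killing_radicalP x :
  reflect (forall y, killing x y = 0) (x \in killing_radical).
Proof.
rewrite memv_ker lfunE; apply: (iffP eqP) => [x0 y|x0].
  by rewrite -killing_formE x0 zero_lfunE.
by apply/lfunP => y; rewrite killing_formE x0 zero_lfunE.
Qed.

(** Cyclicity of the trace: one term is common to both sides, the others differ by moving the factor
    of y around. *)
Lemma killing_lie x y z : killing [lie x, y] z = killing x [lie y, z].
Proof.
rewrite !killingE !ad_mx_lie mulmxBl mulmxBr !linearB/= -!mulmxA.
by rewrite mxtrace_mulC -mulmxA.
Qed.

End Killing.

(** * Cartan's criterion through complexification *)

Section KillingRadical.
Variables (R : rcfType) (g : lieAlgType R).
Local Notation C := R[i].
Local Notation toC := (real_complex R).
Local Notation e := (vbasis {:g}).
Local Notation n := (\dim {:g}).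
Let e_basis : basis_of {:g} e := vbasisP {:g}.

(* [complex_ad v] is the matrix of ad v on the complexification of g, whose
   elements v are given by their coordinates. *)
Definition complex_ad : {linear 'rV[C]_n -> 'M[C]_n} :=
  vec_mx \o mulmxr (map_mx toC (lin1_mx (mxvec \o @ad_mx _ g \o vecof e))).

Lemma complex_adZ c v : complex_ad (c *: v) = c *: complex_ad v.
Proof. exact: linearZ_LR. Qed.

Lemma complex_ad_rVof x :
  complex_ad (map_mx toC (rVof e x)) = map_mx toC (ad_mx x).
Proof.
by rewrite /= -map_mxM/= mul_rV_lin1/= rVofK// -map_vec_mx mxvecK.
Qed.

Lemma row_sum_rVof (v : 'rV[C]_n) :
  v = \sum_i v 0 i *: map_mx toC (rVof e e`_i).
Proof.
rewrite {1}[v]row_sum_delta; apply: eq_bigr => i _.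
by rewrite rVofE// map_delta_mx.
Qed.

(** This is the Jacobi identity on the real basis, extended by complex linearity. *)
Lemma complex_ad_derivation x (T := map_mx toC (ad_mx x)) v :
  complex_ad (v *m T) = complex_ad v *m T - T *m complex_ad v.
Proof.
rewrite [v]row_sum_rVof mulmx_suml !(linear_sum complex_ad).
rewrite mulmx_suml mulmx_sumr -sumrB; apply: eq_bigr => i _.
rewrite -scalemxAl !complex_adZ -scalemxAl -scalemxAr -scalerBr.
rewrite -map_mxM -rVof_lie !complex_ad_rVof ad_mx_lie map_mxB.
by rewrite !map_mxM.
Qed.

Lemma killing_radical_trace u (M : 'rV[C]_n) : (forall y, killing u y = 0) ->
  \tr (map_mx toC (ad_mx u) *m complex_ad M) = 0.
Proof.
move=> u0; rewrite [M]row_sum_rVof (linear_sum complex_ad) mulmx_sumr.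
rewrite raddf_sum big1// => i _.
rewrite complex_adZ -scalemxAr; apply: etrans (mxtraceZ _ _) _.
by rewrite complex_ad_rVof -map_mxM trace_map_mx -killingE u0 rmorph0 mulr0.
Qed.

Lemma killing_radical_nilpotent (S : {vspace g}) :
  (forall u y, u \in S -> killing u y = 0) ->
  forall x, x \in liev S S -> ad_nilpotent x.
Proof.
move=> S0 x xSS; have [y y_der|k kP] :=
  nilpotent_of_derivation_trace_rV (complex_ad_derivation x).
  move: x xSS; apply: liev_ind => [|a x z xy zy|u v uS vS].
  - by rewrite linear0 map_mx0 mul0mx mxtrace0.
  - by rewrite linearP map_mxD map_mxZ mulmxDl -scalemxAl mxtraceD mxtraceZ
      xy zy mulr0 addr0.
  (* Invariance with y in place of an [ad]: the trace against [u, v] becomes, up to sign, that of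
     [ad u] times the commutator of [ad v] and y. By [y_der] the commutator is [complex_ad] of the
     image of v under y, so u annihilates it. *)
  - have := killing_radical_trace (map_mx toC (rVof e v) *m y) (S0 u ^~ uS).
    rewrite y_der complex_ad_rVof mulmxBr linearB/= => trV.
    rewrite ad_mx_lie map_mxB !map_mxM mulmxBl linearB/= -!mulmxA.
    by rewrite [X in X - _]mxtrace_mulC -!mulmxA -opprB trV oppr0.
(* Nilpotency descends to g since real coordinates embed injectively. *)
exists k => v; apply/eqP; rewrite -(rVof_eq0 e_basis) -(map_mx_eq0 toC).
rewrite -(kP (map_mx toC (rVof e v))); apply/eqP.
by elim: k {kP} => //= k <-; rewrite rVof_lie map_mxM.
Qed.

Lemma semisimple_killing_radical : semisimple g -> killing_radical g = 0%VS.
Proof.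
have rad_ideal : lie_ideal (killing_radical g).
  move=> x u /killing_radicalP u0; apply/killing_radicalP => y.
  by rewrite killingC -killing_lie killingC u0.
apply=> //; apply: lie_solvable_of_ad_nilpotent => [x y _|].
  exact: rad_ideal.
by apply: killing_radical_nilpotent => u y /killing_radicalP.
Qed.

(** An injective map from g to its dual, of equal dimension, is onto. Thus [gradient] never falls
    back on the default of [xget]. *)
Lemma semisimple_killing_form_onto : semisimple g ->
  forall a : 'Hom(g, R^o), exists v, forall X, killing v X = a X.
Proof.
move=> /semisimple_killing_radical rad0 a.
have : a \in limg (linfun (@killing_form _ g)).
  suff -> : limg (linfun (@killing_form _ g)) = fullv by exact: memvf.
  apply/eqP; rewrite eqEdim subvf /= limg_dim_eq.
    by rewrite !dimvf /dim/= muln1.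
  by rewrite -/(killing_radical g) rad0 capv0.
case/memv_imgP=> v _ ->; exists v => X.
by rewrite lfunE -killing_formE.
Qed.

End KillingRadical.

(** * Smoothness and differentials of linear functions *)

Section LinearSmooth.
Variables (R : realType).

Lemma linear_rV_continuous n (f : {linear 'rV[R]_n -> R^o}) : continuous f.
Proof.
have -> : (f : _ -> R^o) = fun v => \sum_(i < n) v 0 i * f (delta_mx 0 i).
  apply/funext => v; rewrite {1}[v]row_sum_delta linear_sum.
  by apply: eq_bigr => i _; rewrite linearZ.
apply: continuous_big => [|i _ v]; first exact: add_continuous.
by apply: cvgMr_tmp; [exact: nbhs_filter | exact: coord_continuous].
Qed.

Lemma cst_continuously_differentiable n k (a : R^o) :
  continuously_differentiable k (fun _ : 'rV[R]_n => a).
Proof.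
elim: k a => [|k IHk] a; first exact: cst_continuous.
split=> [x|v]; first exact: differentiable_cst.
suff -> : (fun x => 'D_v (cst a : 'rV[R]_n -> R^o) x) = cst 0 by exact: IHk.
by apply/funext => x; rewrite derive_cst.
Qed.

Lemma linear_continuously_differentiable n k (f : {linear 'rV[R]_n -> R^o}) :
  continuously_differentiable k f.
Proof.
case: k => [|k]; first exact: linear_rV_continuous.
have fdiff x : differentiable f x.
  exact/linear_differentiable/linear_rV_continuous.
split=> // v; suff -> : (fun x => 'D_v f x) = cst (f v).
  exact: cst_continuously_differentiable.
apply/funext => x; rewrite deriveE// diff_lin//.
exact: linear_rV_continuous.
Qed.

Variables (V : vectType R) (b : 'Hom(V, R^o)).

Lemma covector_smooth : smooth b.
Proof.
move=> k; exact: (linear_continuously_differentiable k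
  (b \o vecof (vbasis {:V}))).
Qed.

Lemma differential_covector L : differential b L = b.
Proof.
rewrite /differential (_ : (fun X => _) = b).
  by apply/lfunP => X; rewrite lfunE.
apply/funext => X.
rewrite (diff_lin (f := b \o vecof (vbasis {:V}))) /=.
  by rewrite rVofK// vbasisP.
exact: linear_rV_continuous.
Qed.

End LinearSmooth.

(** * Gradients, the sharp map and the double bracket *)

Section DoubleBracket.
Variables (R : realType) (g : lieAlgType R).
Implicit Types (x L : g) (F : g -> R).

Lemma killing_inj x y : semisimple g ->
  (forall z, killing x z = killing y z) -> x = y.
Proof.
move=> /semisimple_killing_radical rad0 xy; apply/eqP.
rewrite -subr_eq0 -memv0 -rad0.
apply/killing_radicalP => z.
by rewrite killingC linearB/= ![killing z _]killingC xy subrr.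
Qed.

(** Supplies the uniqueness of the vectors that [sharp] and [gdb] define by pairings. *)
Lemma covector_inj x y : semisimple g ->
  (forall b : 'Hom(g, R^o), b x = b y) -> x = y.
Proof.
move=> g_semisimple xy; apply: killing_inj => // z.
by rewrite ![killing _ z]killingC -!killing_formE xy.
Qed.

Lemma killing_gradient F L X : semisimple g ->
  killing (gradient F L) X = differential F L X.
Proof.
move=> /semisimple_killing_form_onto/(_ (differential F L)).
by move=> /(xgetPex 0)/(_ X).
Qed.

(** By invariance, pairing [L, grad F] with the gradient of b gives the Lie-Poisson bracket of F and
    b at L. *)
Lemma sharp_differential Pi F L : semisimple g ->
  poisson_tensor_of (@lie_poisson_bracket R g) Pi -> smooth F ->
  sharp Pi L (differential F L) = [lie L, gradient F L].
Proof.
move=> g_semisimple Pi_lie_poisson F_smooth.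
have lieP (b : 'Hom(g, R^o)) :
    b [lie L, gradient F L] = Pi L (differential F L) b.
  rewrite -{2}(differential_covector b L).
  rewrite (Pi_lie_poisson _ _ F_smooth (covector_smooth b)).
  rewrite /lie_poisson_bracket -killing_lie killingC killing_gradient//.
  by rewrite differential_covector.
apply: xget_unique => // v vP.
by apply: covector_inj => // b; rewrite vP lieP.
Qed.

End DoubleBracket.

Theorem theorem2p4 (R : realType) (g : lieAlgType R)
  (g_semisimple : semisimple g)
  (Pi : contravariant2_field g)
  (Pi_lie_poisson : poisson_tensor_of (@lie_poisson_bracket R g) Pi)
  (G : g -> R) (G_smooth : smooth G) (L : g) :
  gdb Pi (@killing_metric R g) G L = [lie L, [lie L, gradient G L]].
Proof.
have lieP (b : 'Hom(g, R^o)) : b [lie L, [lie L, gradient G L]] =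
    - metriplectic Pi (@killing_metric R g) L (differential G L) b.
  rewrite /metriplectic /killing_metric -{2}(differential_covector b L).
  rewrite !(sharp_differential _ g_semisimple Pi_lie_poisson)//; last first.
    exact: covector_smooth.
  (* Moving L across the form leaves [[L, grad G], L]; the sign from antisymmetry cancels the one in
     the definition of [gdb]. *)
  rewrite -killing_lie [[lie [lie L, _], L]]lieC killingC linearN/= opprK.
  by rewrite killing_gradient// differential_covector.
apply: xget_unique => // v vP.
by apply: covector_inj => // b; rewrite vP lieP.
Qed.
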